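(* Let $k$ be an integer and $n$ a positive integer. In each of the following cases, $\mathrm{CP}(k,n)$ is not Hamiltonian: (i) $n$ is odd and $k$ is even; (ii) $n$ is even and either $\varphi(n)\mid k$ or $\varphi(n)\mid k+n-1$.
   Context: For an integer $k$ and a positive integer $n$, $\mathrm{CP}(k,n)$ is the simple graph with vertex set $\{k,k+1,\ldots,k+n-1\}$ in which two distinct vertices $a,b$ are adjacent if and only if $\gcd(a,b)=1$ (with $\gcd(a,0)=|a|$). For a positive integer $n$, $\varphi(n)$ denotes the product of all odd primes less than $n$ (the empty product being $1$). A graph is Hamiltonian if it contains a cycle through every vertex exactly once. *)

(* Defs.v *)
From HB Require Import structures.
From mathcomp Require Import all_boot all_order all_algebra.
Set Implicit Arguments.
Unset Strict Implicit.
Unset Printing Implicit Defensive.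
Import Order.TTheory GRing.Theory Num.Theory.
Local Open Scope ring_scope.

Record sgraph := SGraph {
  svertex :> finType;
  sadj : rel svertex;
  sadj_sym : symmetric sadj;
  sadj_irrefl : irreflexive sadj }.

(* [cycle] also closes up lists of length at most 2, which are not graph
   cycles: hence the length condition. *)
Definition hamiltonian (G : sgraph) : Prop :=
  exists c : seq G,
    [/\ (3 <= size c)%N, uniq c, cycle (@sadj G) c & forall x : G, x \in c].

Definition CP_vertices (k : int) (n : nat) : seq int :=
  [seq k + i%:Z | i <- iota 0 n].

Lemma mem_CP_vertices (k : int) (n : nat) (x : int) :
  (x \in CP_vertices k n) = (k <= x < k + n%:Z).
Proof.
apply/mapP/andP => [[i]|[lekx ltxk]].
  by rewrite mem_iota add0n => /= ltin ->; rewrite lerDl ltrD2l ltz_nat.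
exists `|x - k|%N; last by rewrite gez0_abs ?subr_ge0// (addrC k) subrK.
by rewrite mem_iota add0n /= -ltz_nat gez0_abs ?subr_ge0// ltrBlDl.
Qed.

Definition CP_adj (k : int) (n : nat) : rel (seq_sub (CP_vertices k n)) :=
  [rel a b | (a != b) && (gcdz (val a) (val b) == 1)].

Lemma CP_adj_sym (k : int) (n : nat) : symmetric (@CP_adj k n).
Proof. by move=> a b; rewrite /CP_adj /= eq_sym gcdzC. Qed.

Lemma CP_adj_irrefl (k : int) (n : nat) : irreflexive (@CP_adj k n).
Proof. by move=> a; rewrite /CP_adj /= eqxx. Qed.

Definition CP (k : int) (n : nat) : sgraph :=
  SGraph (@CP_adj_sym k n) (@CP_adj_irrefl k n).

(* Not Euler's function: the product of the odd primes less than n. *)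
Definition phi (n : nat) : nat := (\prod_(p < n | prime p && odd p) p)%N.

(* Main.v *)
(** No two even numbers are adjacent, so the even vertices on a cycle through
    all vertices are pairwise non-consecutive.  When [n] is odd and [k] is even
    they form more than half of the vertices, which is impossible.  When [n] is
    even they form exactly half of them, so parity alternates along the cycle.
    An end [e] of the interval divisible by [phi n] then has only one possible
    neighbour: if [x] is adjacent to [e] and of the other parity, then [x - e]
    is odd, and an odd prime dividing it would be less than [n], hence divide
    [phi n], [e] and [x]; so [x - e] is a unit.  A cycle of length at least [3]
    needs two distinct neighbours of [e]. *)
Require Import Defs.
From mathcomp Require Import all_boot all_order all_algebra.
From mathcomp Require Import zify.
Import Order.TTheory GRing.Theory Num.Theory.
Local Open Scope ring_scope.

Section Cycles.
Variable T : eqType.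
Implicit Types (c : seq T) (e : rel T) (P : pred T).

(** Once [x] is rotated to the front, its successor is the second entry and its predecessor the
    last; these are distinct entries from length 3 on. *)
Lemma next_neq_prev c (x : T) :
  uniq c -> (2 < size c)%N -> x \in c -> next c x != prev c x.
Proof.
move=> Uc sz xc; case: (rot_to xc) => i s def_s.
rewrite -(next_rot i Uc) -(prev_rot i Uc) def_s.
have: uniq (x :: s) by rewrite -def_s rot_uniq.
have: (2 < size (x :: s))%N by rewrite -def_s size_rot.
case: s {def_s} => [|y [|z s]] // _ /and3P[xNs yNs _].
have prevE : prev [:: x, y, z & s] x = last z s.
  move: xNs; rewrite !inE !negb_or /= => /and3P[/negPf-> /negPf->].
  elim: s z {yNs} => [|t s IHs] z /=; first by rewrite eqxx.
  by rewrite inE negb_or => /andP[/negPf-> /IHs].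
rewrite prevE /= eqxx.
by apply: contraNneq yNs => ->; exact: mem_last.
Qed.

(** [next c] permutes the entries of [c], with inverse [prev c]. *)
Lemma count_next c P : uniq c -> count (P \o next c) c = count P c.
Proof.
move=> Uc; rewrite -count_map; apply/permP/uniq_perm => //.
  by rewrite map_inj_uniq //; apply: can_inj (prev_next Uc).
move=> x; apply/mapP/idP => [[y yc ->]|xc]; first by rewrite mem_next.
by exists (prev c x); rewrite ?mem_prev // next_prev.
Qed.

Section Independent.
Variables (c : seq T) (e : rel T) (P : pred T).
Hypotheses (Uc : uniq c) (Cc : cycle e c).
Hypothesis indepP : forall x y, P x -> P y -> ~~ e x y.

(** By independence, [P] and [P \o next c] are disjoint on [c], and by [count_next] they have equal
    counts. *)
Lemma count_indep_next :
  count (predU P (P \o next c)) c = (count P c).*2.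
Proof.
rewrite -addnn -{2}(count_next c P Uc) -count_predUI.
rewrite (_ : count (predI _ _) c = 0%N) ?addn0 //.
apply/eqP; rewrite -leqn0 leqNgt -has_count; apply/hasPn => x xc /=.
by apply/andP => -[Px Pnx]; have := indepP _ _ Px Pnx; rewrite next_cycle.
Qed.

Lemma count_indep_cycle : ((count P c).*2 <= size c)%N.
Proof. by rewrite -count_indep_next count_size. Qed.

(** Equality forces the union in [count_indep_next] to be all of [c]: of [x] and its successor at
    least one satisfies [P], and independence excludes both. *)
Lemma indep_alternates x :
  (count P c).*2 = size c -> x \in c -> P (next c x) = ~~ P x.
Proof.
rewrite -count_indep_next => /eqP; rewrite -all_count => /allP allU xc.
have := allU _ xc; have := next_cycle Cc xc.
case Px: (P x); case Pn: (P (next c x)); rewrite //= ?Px ?Pn //.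
by move=> exn; have := indepP _ _ Px Pn; rewrite exn.
Qed.

End Independent.
End Cycles.

Definition evenz : pred int := fun x => (2 %| x)%Z.

(** Each pair of consecutive integers contains one even number, whatever the parity of [k]. *)
Lemma count_even_CP_double (k : int) (m : nat) :
  count evenz (CP_vertices k m.*2) = m.
Proof.
elim: m => // m IHm.
rewrite /CP_vertices doubleS -addn2 iotaD map_cat count_cat IHm /= /evenz.
by lia.
Qed.

Lemma count_even_CP_odd (k : int) (m : nat) :
  (2 %| k)%Z -> count evenz (CP_vertices k m.*2.+1) = m.+1.
Proof.
move=> k2; rewrite /CP_vertices -addn1 iotaD map_cat count_cat.
by rewrite count_even_CP_double /= /evenz; lia.
Qed.

Lemma prime_dvd_phi (n p : nat) :
  prime p -> odd p -> (p < n)%N -> (p %| phi n)%N.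
Proof.
move=> p_pr p_odd ltpn; rewrite /phi (bigD1 (Ordinal ltpn)) ?p_pr //=.
exact: dvdn_mulr.
Qed.

Lemma coprime_near_phi_multiple (n : nat) (e x : int) :
  ((phi n)%:Z %| e)%Z -> gcdz e x = 1 -> (`|x - e| < n)%N ->
  evenz x = ~~ evenz e -> `|x - e|%N = 1%N.
Proof.
move=> phi_e gcd_ex ltdn parity; set d := `|x - e|%N in ltdn *.
have d_odd : odd d by move: parity; rewrite /d /evenz; lia.
apply/eqP; apply: contraT => d1.
have p_pr : prime (pdiv d) by rewrite pdiv_prime //; lia.
have p_odd : odd (pdiv d) by apply: dvdn_odd (pdiv_dvd d) d_odd.
have ltpn : (pdiv d < n)%N.
  by apply: leq_ltn_trans ltdn; rewrite pdiv_leq //; lia.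
have pe : ((pdiv d)%:Z %| e)%Z.
  by apply: dvdz_trans phi_e; apply: prime_dvd_phi.
have px : ((pdiv d)%:Z %| x)%Z.
  by rewrite -(subrK e x) rpredD //; apply: pdiv_dvd.
have : ((pdiv d)%:Z %| gcdz e x)%Z by rewrite dvdz_gcd pe px.
by rewrite gcd_ex dvdz1 /= => /eqP p1; rewrite p1 in p_pr.
Qed.

Section CPcycles.
Variables (k : int) (n : nat) (c : seq (CP k n)).
Hypotheses (Uc : uniq c) (allc : forall x : CP k n, x \in c).

(** Transfers length and parity counts from the cycle to the interval. *)
Lemma perm_CP_vertices : perm_eq (map val c) (CP_vertices k n).
Proof.
apply: uniq_perm; first by rewrite map_inj_uniq //; apply: val_inj.
  rewrite map_inj_uniq ?iota_uniq // => i j; lia.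
move=> x; apply/mapP/idP => [[y _ ->]|xV]; first exact: valP.
by exists (SeqSub xV).
Qed.

Lemma size_CP_cycle : size c = n.
Proof.
by have := perm_size perm_CP_vertices; rewrite !size_map size_iota.
Qed.

Lemma count_CP_cycle :
  count (fun x : CP k n => evenz (val x)) c = count evenz (CP_vertices k n).
Proof. by rewrite -(permP perm_CP_vertices evenz) count_map. Qed.

End CPcycles.

Lemma CP_even_indep (k : int) (n : nat) (x y : CP k n) :
  evenz (val x) -> evenz (val y) -> ~~ sadj x y.
Proof.
rewrite /evenz => x2 y2; apply/negP => /andP[_ /eqP g1].
by have : (2 %| gcdz (val x) (val y))%Z; [rewrite dvdz_gcd x2 y2 | rewrite g1].
Qed.

Theorem theorem2p4 (k : int) (n : nat) (n_gt0 : (0 < n)%N) :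
  (odd n -> (2 %| k)%Z -> ~ hamiltonian (CP k n)) /\
  (~~ odd n ->
   ((phi n)%:Z %| k)%Z \/ ((phi n)%:Z %| k + n%:Z - 1)%Z ->
   ~ hamiltonian (CP k n)).
Proof.
split=> [n_odd k2|n_even phi_end] [c [c_gt2 Uc Cc allc]].
  have := count_indep_cycle _ _ _ _ Uc Cc (@CP_even_indep k n).
  rewrite count_CP_cycle // size_CP_cycle //.
  (* For [n = 2m + 1] the bound would read [2(m + 1) <= 2m + 1]. *)
  rewrite -(odd_double_half n) n_odd add1n count_even_CP_odd //; lia.
have half : (count (fun x : CP k n => evenz (val x)) c).*2 = size c.
  rewrite count_CP_cycle // size_CP_cycle //.
  by rewrite -(even_halfK n_even) count_even_CP_double.
have alt := indep_alternates _ _ _ _ Uc Cc (@CP_even_indep k n) _ half.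
have [e [eV phi_e e_end]] : exists e : int,
    [/\ e \in CP_vertices k n, ((phi n)%:Z %| e)%Z
      & e = k \/ e = k + n%:Z - 1].
  by case: phi_end => ?; [exists k | exists (k + n%:Z - 1)];
    split; rewrite ?mem_CP_vertices; auto; lia.
pose v : CP k n := SeqSub eV.
have near (y : CP k n) : sadj v y -> evenz (val y) = ~~ evenz e ->
    `|val y - e|%N = 1%N.
  move=> /andP[_ /eqP g1]; apply: (coprime_near_phi_multiple n) => //.
  have := valP y; have := eV; rewrite !mem_CP_vertices /=; lia.
have next1 := near _ (next_cycle Cc (allc v)) (alt _ (allc v)).
have prev1 : `|val (prev c v) - e|%N = 1%N.
  apply: near; first by rewrite sadj_sym; apply: prev_cycle.
  (* Alternation speaks of successors, so it is applied at the predecessor of [v], whose successor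
     is [v]. *)
  have := alt (prev c v) (allc _); rewrite next_prev //= => ->.
  by rewrite negbK.
have /eqP[] := next_neq_prev _ c v Uc c_gt2 (allc v).
(* Only one of [e - 1] and [e + 1] can lie in the interval, as [e] is an end of it; both neighbours
   of [v] must be that one. *)
apply: val_inj; have := valP (next c v); have := valP (prev c v).
rewrite !mem_CP_vertices /=; move: next1 prev1 => /=.
case: e_end => ->; lia.
Qed.
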